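(* Let $f$ be the density of the power Lindley distribution $PL(\alpha,\beta)$ with $0<\alpha<1/2$ and $\beta>0$. Let $b>0$ and $\gamma\in(\alpha,1/2)$, and let $H_1,H_2,H_3:\mathbb{R}\to\mathbb{R}$ be given for $x\ge 0$ by $$H_1(x)=M_1\frac{x^{1-\alpha}}{1+x^\alpha}\exp(-\beta x^\alpha)\sin\left[2\beta x^\alpha\tan(\pi\alpha)\right],$$ $$H_2(x)=M_2\frac{x^{1-\alpha}}{1+x^\alpha}\exp(\beta x^\alpha-bx^\gamma)\sin\left[bx^\gamma\tan(\pi\gamma)\right],$$ $$H_3(x)=M_3\frac{\sin[\beta x^\alpha\tan(\pi\alpha)-\pi\alpha]+x^\alpha\sin[\beta x^\alpha\tan(\pi\alpha)-2\pi\alpha]}{1+x^\alpha},$$ and $H_i(x)=0$ for $x<0$, where the constants $M_i$ are chosen in such a way that $\sup_{x\in\mathbb{R}}|H_i(x)|=1$, $i=1,2,3$. Then the following sets are Stieltjes classes for $f$: $$S_i=\{f_\epsilon(x): f_\epsilon(x)=f(x)\left[1+\epsilon H_i(x)\right],\ x\in\mathbb{R},\ \epsilon\in[-1,1]\},\quad i=1,2,3.$$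
   Context: For $\alpha,\beta>0$, the power Lindley distribution $PL(\alpha,\beta)$ is the probability distribution with density $f(x)=\frac{\alpha\beta^2}{\beta+1}\left(1+x^\alpha\right)x^{\alpha-1}e^{-\beta x^\alpha}$ for $x>0$ (and $f(x)=0$ for $x\le 0$). All its moments are finite. Perturbation function: let $f$ be the probability density function of a random variable with finite moments of all orders, and let $h$ be an integrable function on $(-\infty,\infty)$ such that $\sup_{x\in\mathbb{R}}|h(x)|=1$. If $\int_{\mathbb{R}}x^k h(x)f(x)\,dx=0$ for all $k\in\mathbb{N}_0=\{0,1,2,\dots\}$, then $h$ is called a perturbation function of the density $f$. Stieltjes class: if $f$ is a probability density function and $h$ is a perturbation function of $f$, the set $S(f,h)=\{f_\epsilon(x): f_\epsilon(x)=f(x)[1+\epsilon h(x)],\ x\in\mathbb{R},\ \epsilon\in[-1,1]\}$ is said to be a Stieltjes class for $f$ based on $h$.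
   Formalization: In the definition of perturbation function, ''integrable on (−∞,∞)'' is read as locally integrable, because H_3 oscillates without decay and is never absolutely integrable on the line; absolute integrability over the whole line is still proved for H_1 and H_2. *)

(* Defs.v *)
From HB Require Import structures.
From mathcomp Require Import all_boot all_order all_algebra.
From mathcomp Require Import all_classical all_reals all_analysis.
Set Implicit Arguments.
Unset Strict Implicit.
Unset Printing Implicit Defensive.
Import Order.TTheory GRing.Theory Num.Theory.
Import numFieldNormedType.Exports.

Local Open Scope classical_set_scope.
Local Open Scope ring_scope.

Definition is_pdf (R : realType) (f : R -> R) : Prop :=
  [/\ measurable_fun setT f, forall x, 0 <= f x &
      (\int[lebesgue_measure]_x (f x)%:E = 1)%E].

Definition finite_moments (R : realType) (f : R -> R) : Prop :=
  forall k : nat,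
    lebesgue_measure.-integrable setT (fun x : R => (x ^+ k * f x)%:E).

(* The supremum is taken in the extended reals, so that it is the true one even
   for an unbounded [h]. *)
Definition sup_norm (R : realType) (h : R -> R) : \bar R :=
  ereal_sup (range (fun x : R => `|h x|%:E)).

(* "Integrable on (-oo, +oo)" is local integrability: a perturbation need not
   vanish at infinity, and absolute integrability over the whole line fails for
   [H3] below. Since [`|h| <= 1] and [f] has finite moments, the functions
   [x ^+ k * h x * f x] are then integrable over the whole line. *)
Definition is_perturbation (R : realType) (f h : R -> R) : Prop :=
  [/\ locally_integrable setT h,
      sup_norm h = 1%:E &
      forall k : nat,
        (\int[lebesgue_measure]_x (x ^+ k * h x * f x)%:E = 0)%E].

Definition stieltjes_set (R : realType) (f h : R -> R) : set (R -> R) :=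
  [set g | exists2 eps : R, -1 <= eps <= 1 &
                            g = (fun x => f x * (1 + eps * h x))].

Definition is_stieltjes_class (R : realType) (f h : R -> R)
    (S : set (R -> R)) : Prop :=
  [/\ is_pdf f, finite_moments f, is_perturbation f h & S = stieltjes_set f h].

Definition power_lindley_pdf (R : realType) (alpha beta : R) (x : R) : R :=
  if 0 < x then
    alpha * beta ^+ 2 / (beta + 1) * (1 + x `^ alpha) * x `^ (alpha - 1)
      * expR (- (beta * x `^ alpha))
  else 0.

Definition H1 (R : realType) (alpha beta M : R) (x : R) : R :=
  if 0 <= x then
    M * (x `^ (1 - alpha) / (1 + x `^ alpha)) * expR (- (beta * x `^ alpha))
      * sin (2 * beta * x `^ alpha * tan (pi * alpha))
  else 0.

Definition H2 (R : realType) (alpha beta b gamma M : R) (x : R) : R :=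
  if 0 <= x then
    M * (x `^ (1 - alpha) / (1 + x `^ alpha))
      * expR (beta * x `^ alpha - b * x `^ gamma)
      * sin (b * x `^ gamma * tan (pi * gamma))
  else 0.

Definition H3 (R : realType) (alpha beta M : R) (x : R) : R :=
  if 0 <= x then
    M * ((sin (beta * x `^ alpha * tan (pi * alpha) - pi * alpha)
          + x `^ alpha
            * sin (beta * x `^ alpha * tan (pi * alpha) - 2 * pi * alpha))
         / (1 + x `^ alpha))
  else 0.

(* Main.v *)
(* For [c > 0], [0 < a < 1/2] and [p > 0] the integral over the positive axis of
   [x ^ (p - 1) * exp (- c x ^ a) * sin (c tan (pi a) x ^ a - p pi)] is [0].
   Indeed, for [r > 0], the function
     [t |-> int x ^ (p - 1) exp (- r cos t x ^ a) sin (r sin t x ^ a - p t / a) dx]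
   is constant on [[0, pi/2[]: the [t]-derivative of the integrand is the
   [x]-derivative of
     [- x ^ p exp (- r cos t x ^ a) cos (r sin t x ^ a - p t / a) / a],
   which vanishes at both ends of the axis.  The constant is [0], as seen at
   [t = 0], and one takes [t = pi a] and [r = c / cos (pi a)].  In the moments of
   [f H1] and [f H2] the factor [x ^ (1 - alpha) / (1 + x ^ alpha)] cancels against
   [f], leaving this integral with [p = k + 1]; the moments of [f H3] are the sum of
   those with [p = k + alpha] and [p = k + 2 alpha]. *)
Require Import Defs.
From HB Require Import structures.
From mathcomp Require Import all_boot all_order all_algebra.
From mathcomp Require Import all_classical all_reals all_analysis.
From mathcomp Require Import measurable_realfun ring lra.
Import Order.TTheory GRing.Theory Num.Theory.
Import numFieldNormedType.Exports.
Local Open Scope classical_set_scope.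
Local Open Scope ring_scope.

(** With [u = c * y / q] the left side is [(q / c) ^ q * (u * exp (- u)) ^ q], and
    [u <= 1 + u <= exp u]. *)
Lemma powR_expR_le {R : realType} (y q c : R) : 0 <= y -> 0 < q -> 0 < c ->
  y `^ q * expR (- (c * y)) <= (q / c) `^ q.
Proof.
move=> y0 q0 c0; rewrite expRN ler_pdivrMr ?expR_gt0//.
have -> : c * y = (c * y / q) * q by rewrite divfK// gt_eqF.
have -> : y = (q / c) * (c * y / q) by field; rewrite !gt_eqF.
have cyq : 0 <= c * y / q by rewrite divr_ge0 ?mulr_ge0// ltW.
rewrite powRM//; last by rewrite divr_ge0// ltW.
have -> : c * (q / c * (c * y / q)) / q * q = c * y / q * q.
  by field; rewrite !gt_eqF.
rewrite ler_wpM2l ?powR_ge0// [leRHS]expRM ge0_ler_powR ?nnegrE ?expR_ge0 ?(ltW q0)//.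
by rewrite (le_trans _ (expR_ge1Dx _))// lerDr.
Qed.

(** * The fundamental theorem of calculus on the open positive axis *)

Section integral_positive_axis.
Context {R : realType}.
Local Notation mu := (@lebesgue_measure R).

Lemma measurable_fun_pos (f : R -> R) :
  (forall x : R, 0 < x -> {for x, continuous f}) -> measurable_fun (`]0%R, +oo[ : set R) f.
Proof.
move=> cf; apply: open_continuous_measurable_fun.
  exact: interval_open.
by move=> x; rewrite inE/= in_itv/= andbT => /cf.
Qed.

Variables F f : R -> R.
Variables l0 l : R.
Hypothesis dF : forall x : R, 0 < x -> is_derive x 1 F (f x).
Hypothesis cf : forall x : R, 0 < x -> {for x, continuous f}.
Hypothesis F0 : F x @[x --> 0^'+] --> l0.
Hypothesis Fy : F x @[x --> +oo] --> l.

(** Compact intervals exhausting the open axis. The upper end is [n.+2] so that the interval is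
    nondegenerate already for [n = 0]. *)
Let D (n : nat) := `[n.+1%:R^-1, n.+2%:R]%classic : set R.

Let D_bigcup : \bigcup_n D n = `]0, +oo[%classic.
Proof.
apply/seteqP; split => x /=.
  by move=> [n _]; rewrite /D/= !in_itv/= andbT => /andP[+ _]; apply: lt_le_trans.
rewrite in_itv/= andbT => x0.
(* A single index handles both ends, since [x + x^-1] exceeds both [x] and [x^-1]. *)
pose n := Num.truncn (x + x^-1).
have xn : x + x^-1 < n.+1%:R.
  by rewrite /n truncnS_gt.
have xV : 0 < x^-1 by rewrite invr_gt0.
exists n => //; rewrite /D/= in_itv/=; apply/andP; split.
  rewrite -(invrK x) lef_pV2 ?posrE//; lra.
rewrite -natr1; lra.
Qed.

Let FTC_D n : (\int[mu]_(x in D n) (f x)%:E = (F n.+2%:R)%:E - (F n.+1%:R^-1)%:E)%E.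
Proof.
have n0 : 0 < n.+1%:R^-1 :> R by rewrite invr_gt0.
have n1 : n.+1%:R^-1 < n.+2%:R :> R.
  by rewrite (@le_lt_trans _ _ 1) ?ltr1n// invf_le1 ?ler1n.
have cF (x : R) : 0 < x -> {for x, continuous F}.
  by move=> /dF dFx; apply: differentiable_continuous; apply/derivable1_diffP.
rewrite /D (continuous_FTC2 (F := F))//.
- apply: continuous_in_subspaceT => x; rewrite inE/= in_itv/= => /andP[xn _].
  by apply: cf; apply: lt_le_trans xn.
- split.
  + move=> x; rewrite in_itv/= => /andP[xn _].
    by have := dF x (lt_trans n0 xn).
  + by apply: cvg_at_right_filter; apply: cF.
  + by apply: cvg_at_left_filter; apply: cF.
- move=> x; rewrite in_itv/= => /andP[xn _].
  by rewrite derive1E; have := dF x (lt_trans n0 xn) => -[].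
Qed.

Let cvg_FTC_D : (\int[mu]_(x in D n) (f x)%:E)%E @[n --> \oo] --> (l - l0)%:E.
Proof.
under eq_cvg do rewrite FTC_D -EFinB.
apply: cvg_EFin; first exact: nearW.
apply: cvgB.
  move/cvg_pinftyP : Fy; apply.
  have := @cvgr_idn R; rewrite -(cvg_shiftn 2).
  by apply: cvg_trans; apply: near_eq_cvg; near=> n; rewrite /= addn2.
move/cvg_at_rightP : F0; apply; split => [n|].
  by rewrite invr_gt0.
exact: cvg_harmonic.
Unshelve. all: by end_near. Qed.

Let ndD : nondecreasing_seq D.
Proof.
move=> m n mn; rewrite subsetEset => x /=; rewrite /D/= !in_itv/= => /andP[mx xm].
apply/andP; split.
  by apply: le_trans mx; rewrite lef_pV2 ?posrE// ler_nat ltnS.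
by apply: le_trans xm _; rewrite ler_nat !ltnS.
Qed.

Let mf n : measurable_fun (D n) f.
Proof.
apply: measurable_funS (measurable_fun_pos _ cf) => //.
by rewrite -D_bigcup; exact: bigcup_sup.
Qed.

Let D_gt0 n (x : R) : D n x -> 0 < x.
Proof.
by move=> Dx; have : (\bigcup_n D n) x by [exists n]; rewrite D_bigcup/= in_itv/= andbT.
Qed.

(** Monotone convergence along [D]. Integrability is not assumed, so the finite value obtained can
    itself serve to prove it. *)
Lemma ge0_FTC_pos : (forall x, 0 < x -> 0 <= f x) ->
  (\int[mu]_(x in `]0%R, +oo[) (f x)%:E = (l - l0)%:E)%E.
Proof.
move=> f0; rewrite -D_bigcup; apply: (cvg_unique _ _ cvg_FTC_D) => //.
apply: ge0_nondecreasing_set_cvg_integral => //.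
- by move=> n; exact: measurable_itv.
- by move=> n; apply/measurable_EFinP; exact: mf.
by move=> n x /D_gt0 x0; rewrite lee_fin f0.
Qed.

(** Monotone convergence applies to the positive and negative parts separately; integrability makes
    the difference of the two limits meaningful. *)
Lemma FTC_pos : mu.-integrable `]0%R, +oo[ (EFin \o f) ->
  (\int[mu]_(x in `]0%R, +oo[) (f x)%:E = (l - l0)%:E)%E.
Proof.
move=> intf; rewrite -D_bigcup.
suff H : (\int[mu]_(x in D n) (f x)%:E)%E @[n --> \oo] -->
    (\int[mu]_(x in \bigcup_n D n) (f x)%:E)%E.
  exact: (cvg_unique _ H cvg_FTC_D).
have mD n : measurable (D n) by exact: measurable_itv.
rewrite integralE; under eq_cvg do rewrite integralE.
apply: cvgeB.
- by apply: integrable_add_def; rewrite D_bigcup.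
- apply: ge0_nondecreasing_set_cvg_integral => //.
  by move=> n; apply: measurable_funepos; apply/measurable_EFinP; exact: mf.
- apply: ge0_nondecreasing_set_cvg_integral => //.
  by move=> n; apply: measurable_funeneg; apply/measurable_EFinP; exact: mf.
Qed.

End integral_positive_axis.

(** * Derivation rules for functions written pointwise *)

Section pointwise_derivation_rules.
Context {R : realType}.
Implicit Types (f g : R -> R) (x a b : R).

(** In this group of rules the function bodies are spelled out under the binder, which is the shape
    that [derive_pointwise] meets in explicit formulas. *)
Lemma is_derive_cstf x a : is_derive x 1 (fun=> a) 0.
Proof. exact: is_derive_cst. Qed.

Lemma is_derive_addf f g x a b : is_derive x 1 f a -> is_derive x 1 g b ->
  is_derive x 1 (fun y => f y + g y) (a + b).
Proof. by move=> df dg; exact: is_deriveD. Qed.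

Lemma is_derive_oppf f x a : is_derive x 1 f a ->
  is_derive x 1 (fun y => - f y) (- a).
Proof. by move=> df; exact: is_deriveN. Qed.

Lemma is_derive_mulf f g x a b : is_derive x 1 f a -> is_derive x 1 g b ->
  is_derive x 1 (fun y => f y * g y) (f x * b + g x * a).
Proof. by move=> df dg; exact: is_deriveM. Qed.

Lemma is_derive_invf f x a : f x != 0 -> is_derive x 1 f a ->
  is_derive x 1 (fun y => (f y)^-1) (- f x ^- 2 * a).
Proof. by move=> fx df; exact: is_deriveV. Qed.

Lemma is_derive_expRf f x a : is_derive x 1 f a ->
  is_derive x 1 (fun y => expR (f y)) (expR (f x) * a).
Proof. by move=> df; exact: is_derive1_comp. Qed.

Lemma is_derive_sinf f x a : is_derive x 1 f a ->
  is_derive x 1 (fun y => sin (f y)) (cos (f x) * a).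
Proof. by move=> df; exact: is_derive1_comp. Qed.

Lemma is_derive_cosf f x a : is_derive x 1 f a ->
  is_derive x 1 (fun y => cos (f y)) (- sin (f x) * a).
Proof. by move=> df; exact: is_derive1_comp. Qed.

Lemma is_derive_powRf x a : 0 < x ->
  is_derive x 1 (fun y => y `^ a) (a * x `^ (a - 1)).
Proof. exact: is_derive1_powR. Qed.

Lemma is_derive_derivable f x :
  (exists df, is_derive x 1 f df) -> derivable f x 1.
Proof. by case=> df []. Qed.

Lemma derivable_pos_continuous f :
  (forall x, 0 < x -> derivable f x 1) ->
  forall x, 0 < x -> {for x, continuous f}.
Proof.
by move=> df x /df dfx; apply: differentiable_continuous; apply/derivable1_diffP.
Qed.

End pointwise_derivation_rules.

(* [notypeclasses] prevents an exponential instance search at every step. *)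
Ltac derive_pointwise := repeat first
  [ notypeclasses refine (is_derive_cstf _ _)
  | notypeclasses refine (is_derive_id _ _)
  | notypeclasses refine (is_derive_oppf _ _ _ _)
  | notypeclasses refine (is_derive_addf _ _ _ _ _ _ _)
  | notypeclasses refine (is_derive_mulf _ _ _ _ _ _ _)
  | notypeclasses refine (is_derive_expRf _ _ _ _)
  | notypeclasses refine (is_derive_sinf _ _ _ _)
  | notypeclasses refine (is_derive_cosf _ _ _ _)
  | notypeclasses refine (is_derive_powRf _ _ _)
  | notypeclasses refine (is_derive_invf _ _ _ _ _) ].

Ltac derive_eq :=
  notypeclasses refine (is_derive_eq _ _); [derive_pointwise | rewrite /=].

Ltac derivable_pointwise :=
  apply: is_derive_derivable; eexists; derive_pointwise.

(** * Bounds, limits and integrability of powers times stretched exponentials *)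

Section stretched_exponential.
Context {R : realType}.
Local Notation mu := (@lebesgue_measure R).
Implicit Types a c p x : R.

(** The substitution [y = x ^ a] turns [x ^ p] into [y ^ (p / a)]. *)
Lemma powR_expR_powR_le p a c x : 0 <= x -> 0 < p -> 0 < a -> 0 < c ->
  x `^ p * expR (- (c * x `^ a)) <= (p / a / c) `^ (p / a).
Proof.
move=> x0 p0 a0 c0.
have -> : x `^ p = (x `^ a) `^ (p / a) by rewrite -powRrM mulrC divfK// gt_eqF.
by apply: powR_expR_le => //; rewrite ?powR_ge0 ?divr_gt0.
Qed.

Lemma powR_cvgy p : 0 < p -> x `^ p @[x --> +oo] --> +oo.
Proof.
move=> p0; apply/cvgryPge => A; near=> x.
have hx : (`|A| + 1) `^ (p^-1) <= x by near: x; apply: nbhs_pinfty_ge; rewrite num_real.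
rewrite (le_trans (ler_norm A))// (@le_trans _ _ (`|A| + 1)) ?lerDl//.
have -> : `|A| + 1 = ((`|A| + 1) `^ (p^-1)) `^ p.
  by rewrite -powRrM mulVf ?gt_eqF// powRr1// addr_ge0.
have x0 := le_trans (powR_ge0 _ _) hx.
by apply: ge0_ler_powR; rewrite ?nnegrE ?powR_ge0// ltW.
Unshelve. all: by end_near. Qed.

Lemma powR_expR_powR_cvgy p a c : 0 < p -> 0 < a -> 0 < c ->
  x `^ p * expR (- (c * x `^ a)) @[x --> +oo] --> 0.
Proof.
move=> p0 a0 c0.
(* The uniform bound is taken at exponent [p + 1]; the spare factor [x] turns it into the majorant
   [K / x], which tends to 0. *)
pose K := ((p + 1) / a / c) `^ ((p + 1) / a).
apply: (@squeeze_cvgr _ _ _ _ (cst 0) (fun x => K * x^-1)).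
- near=> x.
  have x0 : 0 < x by near: x; apply: nbhs_pinfty_gt; rewrite num_real.
  rewrite /= mulr_ge0 ?powR_ge0 ?expR_ge0//= ler_pdivlMr//.
  have := @powR_expR_powR_le (p + 1) a c x (ltW x0) (addr_gt0 p0 ltr01) a0 c0.
  rewrite powRD; last by rewrite (gt_eqF x0) implybT.
  by rewrite powRr1 ?(ltW x0)// => h; rewrite mulrAC.
- exact: cvg_cst.
- rewrite -[X in _ --> X](mulr0 K); apply: cvgMl_tmp.
  by apply/gtr0_cvgV0; [near=> x; near: x; apply: nbhs_pinfty_gt; rewrite num_real|exact: cvg_id].
Unshelve. all: by end_near. Qed.

Lemma powR_expR_powR_cvg0 p a c : 0 < p -> 0 < c ->
  x `^ p * expR (- (c * x `^ a)) @[x --> 0^'+] --> 0.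
Proof.
move=> p0 c0.
apply: (@squeeze_cvgr _ _ _ _ (cst 0) (fun x => x `^ p)).
- near=> x.
  rewrite /= mulr_ge0 ?powR_ge0 ?expR_ge0//= ler_piMr ?powR_ge0//.
  by rewrite -expR0 ler_expR oppr_le0 mulr_ge0 ?powR_ge0// ltW.
- exact: cvg_cst.
- exact: powR_cvg0.
Unshelve. all: by end_near. Qed.

Lemma le_integrable_pos (f g : R -> R) :
  (forall x, 0 < x -> derivable f x 1) ->
  (forall x, 0 < x -> `|f x| <= g x) ->
  mu.-integrable `]0, +oo[ (fun x => (g x)%:E) ->
  mu.-integrable `]0, +oo[ (fun x => (f x)%:E).
Proof.
move=> df_ fg; apply: le_integrable; first exact: measurable_itv.
  apply/measurable_EFinP; apply: measurable_fun_pos.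
  exact: derivable_pos_continuous df_.
move=> x; rewrite /= in_itv/= andbT => x0; rewrite lee_fin.
by rewrite (le_trans (fg x x0))// ler_norm.
Qed.

(* This integrand has the antiderivative [- 1 / (p (1 + x ^ p))], and it dominates
   [x ^ (p - 1) exp (- c x ^ a)] up to a constant. *)
Lemma integrable_powR_div p : 0 < p ->
  mu.-integrable `]0, +oo[ (fun x => (x `^ (p - 1) / (1 + x `^ p) ^+ 2)%:E).
Proof.
move=> p0.
have D0 x : 0 < 1 + x `^ p by rewrite ltr_pwDl ?powR_ge0.
have D0' x : 1 + x `^ p != 0 by rewrite gt_eqF.
have df (x : R) : 0 < x ->
    {for x, continuous (fun x => x `^ (p - 1) / (1 + x `^ p) ^+ 2)}.
  apply: derivable_pos_continuous => {}x x0.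
  by derivable_pointwise => //; rewrite /= mulf_neq0.
apply/integrableP; split.
  by apply/measurable_EFinP; apply: measurable_fun_pos.
under eq_integral => x _ do rewrite gee0_abs ?lee_fin ?divr_ge0 ?powR_ge0 ?exprn_ge0 ?(ltW (D0 x))//.
suff -> : (\int[mu]_(x in `]0%R, +oo[) (x `^ (p - 1) / (1 + x `^ p) ^+ 2)%:E =
    (- (p^-1 * 0) - - (p^-1 * 1^-1))%:E)%E by rewrite ltry.
apply: (@ge0_FTC_pos _ (fun x => - (p^-1 * (1 + x `^ p)^-1))) => //.
- move=> x x0.
  apply: is_derive_eq; first by derive_pointwise.
  by rewrite /=; field; rewrite D0' gt_eqF.
- apply: cvgN; apply: cvgMl_tmp; apply: cvgV => //.
  rewrite -[X in _ --> X]addr0; apply: cvgD; [exact: cvg_cst|exact: powR_cvg0].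
- apply: cvgN; apply: cvgMl_tmp; apply/gtr0_cvgV0; first by near=> x; exact: D0.
  apply/cvgryPge => A; near=> x.
  suff : A <= x `^ p by lra.
  by near: x; apply: cvgry_ge; exact: powR_cvgy.
- by move=> x x0; rewrite divr_ge0 ?powR_ge0 ?exprn_ge0 ?(ltW (D0 x)).
Unshelve. all: by end_near. Qed.

Lemma integrable_powR_expR_powR p a c : 0 < p -> 0 < a -> 0 < c ->
  mu.-integrable `]0, +oo[
    (fun x => (x `^ (p - 1) * expR (- (c * x `^ a)))%:E).
Proof.
move=> p0 a0 c0.
(* Write [y = x ^ p], [E] for the exponential and [C] for the bound on [y ^ 2 * E]. Since
   [(1 + y) ^ 2 <= 2 + 2 * y ^ 2] and [E <= 1], one has [E * (1 + y) ^ 2 <= 2 + 2 * C = K]. *)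
pose K := 2 + 2 * (2 * p / a / c) `^ (2 * p / a).
have K0 : 0 <= K by rewrite addr_ge0// mulr_ge0// powR_ge0.
have D0 x : 0 < 1 + x `^ p by rewrite ltr_pwDl ?powR_ge0.
apply: (@le_integrable_pos _ (fun x => K * (x `^ (p - 1) / (1 + x `^ p) ^+ 2))).
- by move=> x x0; derivable_pointwise.
- move=> x x0; rewrite ger0_norm ?mulr_ge0 ?powR_ge0 ?expR_ge0//.
  rewrite mulrCA ler_wpM2l ?powR_ge0// ler_pdivlMr ?exprn_gt0//.
  have E0 : 0 < expR (- (c * x `^ a)) by exact: expR_gt0.
  have E1 : expR (- (c * x `^ a)) <= 1.
    by rewrite -expR0 ler_expR oppr_le0 mulr_ge0 ?powR_ge0// ltW.
  have := @powR_expR_powR_le (2 * p) a c x (ltW x0) (mulr_gt0 (ltr0Sn R 1) p0) a0 c0.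
  have -> : x `^ (2 * p) = x `^ p ^+ 2.
    by rewrite mulrC powRrM powR_mulrn ?powR_ge0.
  rewrite /K; move: E0 E1 (sqr_ge0 (x `^ p - 1)) => /=.
  set E := expR _; set y := x `^ p; set C := _ `^ _ => E0 E1 yy.
  nra.
- by apply: (@integrableZl _ _ _ mu _ _ K _ (integrable_powR_div p p0)); exact: measurable_itv.
Qed.

End stretched_exponential.

(** * The oscillating integral and its independence of the angle *)

Section oscillating_integral.
Context {R : realType}.
Local Notation mu := (@lebesgue_measure R).
Variables p a r : R.
Hypotheses (p0 : 0 < p) (a0 : 0 < a) (r0 : 0 < r).
Implicit Types t x : R.

Let phase t x := r * sin t * x `^ a - p / a * t.

Let osc t x := x `^ (p - 1) * expR (- (r * cos t * x `^ a)) * sin (phase t x).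

(** The common value of the [t]-derivative of [osc] and the [x]-derivative of [prim]. *)
Let dosc t x := x `^ (p - 1) * expR (- (r * cos t * x `^ a)) *
  (r * sin t * x `^ a * sin (phase t x) +
   (r * cos t * x `^ a - p / a) * cos (phase t x)).

Let prim t x := - (a^-1 * (x `^ p * expR (- (r * cos t * x `^ a)) * cos (phase t x))).

Local Lemma is_derive_osc t x : is_derive t 1 (osc ^~ x) (dosc t x).
Proof.
rewrite /osc /dosc /phase; apply: is_derive_eq.
rewrite /GRing.scale/=; ring.
Qed.

Local Lemma is_derive_prim t x : 0 < x -> is_derive x 1 (prim t) (dosc t x).
Proof.
move=> x0; rewrite /prim /dosc /phase; derive_eq => //.
have powB1 q : x `^ (q - 1) = x `^ q / x.
  by rewrite powRB ?powRr1 ?ltW// (gt_eqF x0) implybT.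
rewrite /= !powB1.
by field; rewrite !gt_eqF.
Qed.

Local Lemma osc_le t x : `|osc t x| <= x `^ (p - 1) * expR (- (r * cos t * x `^ a)).
Proof.
rewrite /osc normrM ger0_norm ?mulr_ge0 ?powR_ge0 ?expR_ge0//.
by rewrite ler_piMr ?sin_max// mulr_ge0 ?powR_ge0 ?expR_ge0.
Qed.

Local Lemma prim_le t x : `|prim t x| <= a^-1 * (x `^ p * expR (- (r * cos t * x `^ a))).
Proof.
have ai : 0 <= a^-1 by rewrite invr_ge0 ltW.
rewrite /prim normrN normrM (ger0_norm ai) ler_wpM2l// normrM.
rewrite ger0_norm ?mulr_ge0 ?powR_ge0 ?expR_ge0//.
by rewrite ler_piMr ?cos_max// mulr_ge0 ?powR_ge0 ?expR_ge0.
Qed.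

(** An integrable majorant of [dosc t], the same for all [t] with [r * cos t >= c], as
    differentiation under the integral sign requires. *)
Let bound c x := 2 * r * (x `^ (p + a - 1) * expR (- (c * x `^ a))) +
  p / a * (x `^ (p - 1) * expR (- (c * x `^ a))).

Local Lemma bound_ge0 c x : 0 <= bound c x.
Proof.
by rewrite addr_ge0// !mulr_ge0 ?powR_ge0 ?expR_ge0 ?invr_ge0// ltW.
Qed.

Local Lemma dosc_le c t x : c <= r * cos t -> 0 < x -> `|dosc t x| <= bound c x.
Proof.
move=> ct x0; rewrite /dosc normrM ger0_norm ?mulr_ge0 ?powR_ge0 ?expR_ge0//.
have -> : bound c x = x `^ (p - 1) * expR (- (c * x `^ a)) * (2 * r * x `^ a + p / a).
  rewrite /bound [p + a - 1]addrAC [x `^ (p - 1 + a)]powRD; last first.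
    by rewrite (gt_eqF x0) implybT.
  ring.
rewrite ler_pM ?mulr_ge0 ?powR_ge0 ?expR_ge0 ?normr_ge0//.
  by rewrite ler_wpM2l ?powR_ge0// ler_expR lerN2 ler_wpM2r ?powR_ge0.
have X0 : 0 <= r * x `^ a by rewrite mulr_ge0 ?powR_ge0 ?ltW.
have pa : 0 <= p / a by rewrite divr_ge0 ?ltW.
(* The bracket in [dosc] splits into three terms with coefficients [X], [X] and [q], each
   multiplying a quantity of absolute value at most 1; the sum is at most [2 * X + q]. *)
have B (u v : R) : `|u| <= 1 -> `|v| <= 1 -> `|u * v| <= 1.
  by move=> u1 v1; rewrite normrM mulr_ile1.
have := B _ _ (sin_max t) (sin_max (phase t x)).
have := B _ _ (cos_max t) (cos_max (phase t x)).
have := cos_max (phase t x).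
rewrite !ler_norml; set X := r * _ in X0 *; set q := p / a in pa *.
move=> /andP[h1 h2] /andP[h3 h4] /andP[h5 h6].
have -> : r * sin t * x `^ a * sin (phase t x) +
   (r * cos t * x `^ a - q) * cos (phase t x) =
   X * (sin t * sin (phase t x)) + X * (cos t * cos (phase t x)) -
   q * cos (phase t x) by rewrite /X; ring.
have -> : 2 * r * x `^ a = 2 * X by rewrite /X; ring.
move: h1 h2 h3 h4 h5 h6; set u := cos t * _; set v := sin t * _; set w := cos _.
by move=> *; apply/andP; split; nra.
Qed.

Lemma integrable_osc t : 0 < cos t -> mu.-integrable `]0, +oo[ (fun x => (osc t x)%:E).
Proof.
move=> ct; apply: (le_integrable_pos _ _ _ _ (integrable_powR_expR_powR _ _ _ p0 a0 _)); last first.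
- exact: (mulr_gt0 r0 ct).
- by move=> x x0; exact: osc_le.
- by move=> x x0; rewrite /osc /phase; derivable_pointwise.
Qed.

Local Lemma integrable_bound c : 0 < c -> mu.-integrable `]0, +oo[ (fun x => (bound c x)%:E).
Proof.
move=> c0; rewrite /bound.
have := integrableD _ (integrableZl _ (2 * r) (integrable_powR_expR_powR _ _ _ (addr_gt0 p0 a0) a0 c0))
  (integrableZl _ (p / a) (integrable_powR_expR_powR _ _ _ p0 a0 c0)).
by apply; exact: measurable_itv.
Qed.

Local Lemma integral_dosc t : 0 < cos t -> \int[mu]_(x in `]0, +oo[) dosc t x = 0.
Proof.
move=> ct.
have c0 := mulr_gt0 r0 ct.
suff H : (\int[mu]_(x in `]0%R, +oo[) (dosc t x)%:E = (0 - 0)%:E)%E.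
  by rewrite /Rintegral H subrr.
apply: (FTC_pos _ _ _ _ (is_derive_prim t)).
- apply: derivable_pos_continuous => x x0.
  by rewrite /dosc /phase; derivable_pointwise.
- apply: norm_cvg0.
  apply: (@squeeze_cvgr _ _ _ _ (cst 0)
    (fun x => a^-1 * (x `^ p * expR (- (r * cos t * x `^ a))))).
  + by apply: nearW => x; rewrite /= normr_ge0 prim_le.
  + exact: cvg_cst.
  + by rewrite -[X in _ --> X](mulr0 a^-1); apply: cvgMl_tmp; exact: powR_expR_powR_cvg0.
- apply: norm_cvg0.
  apply: (@squeeze_cvgr _ _ _ _ (cst 0)
    (fun x => a^-1 * (x `^ p * expR (- (r * cos t * x `^ a))))).
  + by apply: nearW => x; rewrite /= normr_ge0 prim_le.
  + exact: cvg_cst.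
  + by rewrite -[X in _ --> X](mulr0 a^-1); apply: cvgMl_tmp; exact: powR_expR_powR_cvgy.
- apply: (le_integrable_pos _ _ _ _ (integrable_bound _ c0)); last first.
    by move=> x x0; exact: dosc_le.
  by move=> x x0; rewrite /dosc /phase; derivable_pointwise.
Qed.

Lemma integral_osc0 t : 0 <= t < pi / 2 ->
  (\int[mu]_(x in `]0%R, +oo[) (x `^ (p - 1) * expR (- (r * cos t * x `^ a)) *
     sin (r * sin t * x `^ a - p / a * t))%:E = 0)%E.
Proof.
move=> /andP[t0 tpi].
have ct : 0 < cos t by apply: cos_gt0_pihalf; have := pi_gt0 R; lra.
rewrite -[LHS]fineK; last first.
  by apply: integrable_fin_num; [exact: measurable_itv|exact: integrable_osc].
congr EFin; rewrite -/(Rintegral _ _ _) -/(osc t _).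
pose J s := \int[mu]_(x in `]0, +oo[) osc s x.
have J0 : J 0 = 0.
  rewrite /J /Rintegral integral0_eq// => x _.
  by rewrite /osc /phase sin0 !mulr0 mul0r subr0 sin0 mulr0.
(* The mean value theorem below needs a nondegenerate segment. *)
have [<-//|t_neq0] := eqVneq 0 t.
have {t_neq0} t_gt0 : 0 < t by rewrite lt_neqAle t_neq0.
(* The midpoint of [t] and [pi / 2]. On the open interval from [- T] to [T], which contains the
   whole segment from 0 to [t], the cosine stays above [cos T > 0], so [bound (r * cos T)] dominates
   throughout. *)
pose T := (t + pi / 2) / 2.
have tT : t < T by rewrite /T; lra.
have Tpi : T < pi / 2 by rewrite /T; lra.
have cT : 0 < cos T by apply: cos_gt0_pihalf; have := pi_gt0 R; lra.
have cosT s : - T < s < T -> cos T <= cos s.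
  move=> /andP[Ts sT]; rewrite -(cos_norm s).
  have sT' : `|s| < T by rewrite ltr_norml Ts.
  have s0 := normr_ge0 s.
  have p2 := pi_gt0 R.
  by rewrite ltW// ltr_cos ?in_itv//=; apply/andP; split; lra.
have cos0 s : - T < s < T -> 0 < cos s by move=> /cosT; exact: lt_le_trans.
have dJ s : - T < s < T -> is_derive s 1 J 0.
  move=> sT.
  have Is : `]- T, T[%classic s by rewrite /= in_itv.
  have intI q : `]- T, T[%classic q -> mu.-integrable `]0, +oo[ (EFin \o osc q).
    by rewrite /= in_itv/= => /cos0; exact: integrable_osc.
  have dI q x : `]- T, T[%classic q -> `]0, +oo[%classic x -> derivable (osc ^~ x) q 1.
    by move=> _ _; have [] := is_derive_osc q x.
  have ubI q x : `]- T, T[%classic q -> `]0, +oo[%classic x ->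
      `|partial1of2 osc q x| <= bound (r * cos T) x.
    rewrite /= !in_itv/= andbT => qT x0.
    rewrite partial1of2E; have [_ ->] := is_derive_osc q x.
    by apply: dosc_le => //; rewrite ler_wpM2l ?(ltW r0)// cosT.
  have intb := integrable_bound _ (mulr_gt0 r0 cT).
  apply: DeriveDef.
    by apply: (derivable_under_integral _ Is intI dI (bound_ge0 _) intb ubI); exact: measurable_itv.
  rewrite -derive1E (differentiation_under_integral _ Is intI dI (bound_ge0 _) intb ubI);
    last exact: measurable_itv.
  rewrite -[RHS](integral_dosc s (cos0 s sT)); apply: eq_Rintegral => x _.
  by rewrite partial1of2E; have [_ ->] := is_derive_osc s x.
have itvT s : 0 <= s <= t -> - T < s < T.
  by move=> /andP[s0 st]; apply/andP; split; lra.
have dJ' s : s \in `]0, t[ -> is_derive s 1 J (cst 0 s).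
  by rewrite in_itv/= => /andP[/ltW s0 /ltW st]; apply: dJ; apply: itvT; rewrite s0.
have cJ : {within `[0, t], continuous J}.
  by apply: derivable_within_continuous => s; rewrite in_itv/= => /itvT/dJ [].
have [c _] := MVT t_gt0 dJ' cJ.
by rewrite /= mul0r J0 subr0.
Qed.

End oscillating_integral.

(** The phases [p * pi] of the vanishing integrals differ from the angles in the perturbations by
    integer multiples of [pi], which this turns into signs. *)
Lemma sin_natpi {R : realType} (x : R) (n : nat) :
  sin (x - n%:R * pi) = (-1) ^+ n * sin x.
Proof.
elim: n => [|n IH]; first by rewrite mul0r subr0 expr0 mul1r.
rewrite exprS -mulrA -IH mulN1r.
have -> : x - n%:R * pi = x - n.+1%:R * pi + pi by rewrite -natr1; ring.
by rewrite sinDpi opprK.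
Qed.

(** Integrability is recorded along with the value because linearity of the integral is later used
    to scale and add such integrands. *)
Lemma integral_sin_tan0 {R : realType} (p a c : R) :
  0 < p -> 0 < a < 1 / 2 -> 0 < c ->
  lebesgue_measure.-integrable `]0, +oo[
    (fun x => (x `^ (p - 1) * expR (- (c * x `^ a)) *
      sin (c * x `^ a * tan (pi * a) - p * pi))%:E) /\
  (\int[lebesgue_measure]_(x in `]0%R, +oo[)
    (x `^ (p - 1) * expR (- (c * x `^ a)) *
      sin (c * x `^ a * tan (pi * a) - p * pi))%:E = 0)%E.
Proof.
move=> p0 /andP[a0 a1] c0.
have pi0 := pi_gt0 R.
have t0 : 0 <= pi * a by rewrite mulr_ge0 ?ltW.
have tpi : pi * a < pi / 2 by nra.
have ct : 0 < cos (pi * a) by apply: cos_gt0_pihalf; lra.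
have -> : (fun x : R => (x `^ (p - 1) * expR (- (c * x `^ a)) *
      sin (c * x `^ a * tan (pi * a) - p * pi))%:E) =
    (fun x => (x `^ (p - 1) *
      expR (- (c / cos (pi * a) * cos (pi * a) * x `^ a)) *
      sin (c / cos (pi * a) * sin (pi * a) * x `^ a - p / a * (pi * a)))%:E).
  apply/funext => x; congr (_ * expR (- _) * sin _)%:E.
    by rewrite divfK// gt_eqF.
  by rewrite /tan; field; rewrite !gt_eqF.
have r0 : 0 < c / cos (pi * a) by rewrite divr_gt0.
split; first exact: integrable_osc.
by apply: integral_osc0 => //; rewrite t0.
Qed.

(** * Passing from the positive axis to the whole line *)

Section line.
Context {R : realType}.
Local Notation mu := (@lebesgue_measure R).

(** The value at 0 is left free, since [H3] need not vanish there; every function is measurable on a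
    singleton. *)
Lemma measurable_fun_line (h g : R -> R) : (forall x, x < 0 -> h x = 0) ->
  (forall x, 0 < x -> h x = g x) -> (forall x, 0 < x -> derivable g x 1) ->
  measurable_fun setT h.
Proof.
move=> hN hP dg.
have -> : [set: R] = `]-oo, 0%R[ `|` ([set 0] `|` `]0%R, +oo[).
  apply/seteqP; split => // x _ /=; rewrite !in_itv/= andbT.
  by case: (ltgtP x 0) => [|_|->]; [left|right; right|right; left].
apply/measurable_funU; [exact: measurable_itv| | ].
  by apply: measurableU => //; exact: measurable_itv.
split.
  apply: (eq_measurable_fun (fun=> 0 : R) _ (measurable_cst _)).
  by move=> x; rewrite inE/= in_itv/= => /hN.
apply/measurable_funU => //; split; first exact: measurable_fun_set1.
apply: (eq_measurable_fun g).
  by move=> x; rewrite inE/= in_itv/= andbT => /hP.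
apply: measurable_fun_pos; exact: derivable_pos_continuous.
Qed.

Let patch_pos (h : R -> R) : (forall x, x <= 0 -> h x = 0) ->
  (fun x => (h x)%:E) \_ `]0%R, +oo[ = (fun x => (h x)%:E).
Proof.
move=> hN; apply/funext => x; rewrite patchE; case: ifPn => //.
by rewrite notin_setE/= in_itv/= andbT => /negP; rewrite -leNgt => /hN ->.
Qed.

Lemma integral_line (h g : R -> R) : (forall x, x <= 0 -> h x = 0) ->
  (forall x, 0 < x -> h x = g x) ->
  (\int[mu]_x (h x)%:E = \int[mu]_(x in `]0%R, +oo[) (g x)%:E)%E.
Proof.
move=> hN hP; rewrite -(patch_pos _ hN) -integral_mkcond.
by apply: eq_integral => x; rewrite inE/= in_itv/= andbT => /hP ->.
Qed.

Lemma integrable_line (h g : R -> R) : (forall x, x <= 0 -> h x = 0) ->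
  (forall x, 0 < x -> h x = g x) ->
  mu.-integrable `]0%R, +oo[ (fun x => (g x)%:E) ->
  mu.-integrable setT (fun x => (h x)%:E).
Proof.
move=> hN hP; rewrite -(patch_pos _ hN) => intg.
apply: (integrable_mkcond _ _).1; first exact: measurable_itv.
apply: eq_integrable intg; first exact: measurable_itv.
by move=> x; rewrite inE/= in_itv/= andbT => /hP ->.
Qed.

End line.

(** Compact sets have finite measure, so the constant 1 is an integrable majorant on each. This
    serves [H3], which does not decay. *)
Lemma locally_integrable_le1 {R : realType} (h : R -> R) :
  measurable_fun setT h -> (forall x, `|h x| <= 1) -> locally_integrable setT h.
Proof.
move=> mh h1; split => //; first exact: openT.
move=> K _ cK.
apply: (@le_lt_trans _ _ (\int[lebesgue_measure]_(x in K) cst 1 x)%E).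
  apply: ge0_le_integral => //=; first exact: compact_measurable.
  - apply/measurable_EFinP; apply: measurableT_comp => //; exact: measurable_funS mh.
  - by move=> y _; rewrite lee_fin.
by rewrite integral_cst//= ?mul1e; [exact: compact_finite_measure|exact: compact_measurable].
Qed.

Lemma sup_norm_le1 {R : realType} (h : R -> R) (x : R) :
  sup_norm h = 1%:E -> `|h x| <= 1.
Proof.
move=> h1; rewrite -lee_fin -h1; apply: ereal_sup_ubound; by exists x.
Qed.

(** * The power Lindley density, its moments and the vanishing moments *)

Section power_lindley.
Context {R : realType}.
Variables alpha beta : R.
Hypotheses (alpha0 : 0 < alpha) (beta0 : 0 < beta).
Local Notation mu := (@lebesgue_measure R).
Local Notation f := (power_lindley_pdf alpha beta).
Local Notation C := (alpha * beta ^+ 2 / (beta + 1)).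
Implicit Types x y : R.

Lemma power_lindley_le0 x : x <= 0 -> f x = 0.
Proof. by rewrite /power_lindley_pdf leNgt => /negbTE ->. Qed.

Lemma power_lindley_gt0 x : 0 < x -> f x =
  C * (1 + x `^ alpha) * x `^ (alpha - 1) * expR (- (beta * x `^ alpha)).
Proof. by rewrite /power_lindley_pdf => ->. Qed.

Let C0 : 0 < C.
Proof. by rewrite divr_gt0 ?mulr_gt0 ?exprn_gt0 ?addr_gt0. Qed.

Lemma power_lindley_ge0 x : 0 <= f x.
Proof.
rewrite /power_lindley_pdf; case: ifPn => // x0.
apply: mulr_ge0 (expR_ge0 _); apply: mulr_ge0 (powR_ge0 _ _).
by apply: mulr_ge0 (ltW C0) _; rewrite addr_ge0 ?powR_ge0.
Qed.

Lemma measurable_power_lindley : measurable_fun setT f.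
Proof.
apply: (measurable_fun_line _ _ _ power_lindley_gt0) => x x0.
  by rewrite power_lindley_le0// ltW.
by derivable_pointwise.
Qed.

Lemma integral_power_lindley : (\int[mu]_x (f x)%:E = 1)%E.
Proof.
rewrite (integral_line _ _ power_lindley_le0 power_lindley_gt0).
(* The distribution function minus 1, so it runs from -1 at 0 to 0 at infinity. *)
pose cdf x := - expR (- (beta * x `^ alpha)) -
  beta / (beta + 1) * (x `^ alpha * expR (- (beta * x `^ alpha))).
have -> : 1%E = (- 0 - beta / (beta + 1) * 0 - (- 1 - beta / (beta + 1) * 0))%:E :> \bar R.
  by congr EFin; ring.
apply: (ge0_FTC_pos cdf).
- move=> x x0; rewrite /cdf; derive_eq => //.
  have powB1 : x `^ (alpha - 1) = x `^ alpha / x.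
    by rewrite powRB ?powRr1 ?ltW// (gt_eqF x0) implybT.
  by rewrite powB1; field; rewrite !gt_eqF ?addr_gt0.
- apply: derivable_pos_continuous => x x0; by derivable_pointwise.
- apply: cvgB.
    apply: cvgN; rewrite -[X in _ --> X]expR0; apply: continuous_cvg.
      exact: continuous_expR.
    rewrite -[X in _ --> X]oppr0 -[X in _ --> - X](mulr0 beta).
    by apply: cvgN; apply: cvgMl_tmp; exact: powR_cvg0.
  by apply: cvgMl_tmp; exact: powR_expR_powR_cvg0.
- apply: cvgB; last by apply: cvgMl_tmp; exact: powR_expR_powR_cvgy.
  apply: cvgN; apply: (@squeeze_cvgr _ _ _ _ (cst 0)
    (fun x => x `^ alpha * expR (- (beta * x `^ alpha)))).
  (* For [x >= 1] one has [x ^ alpha >= 1], so the exponential lies below a product already known to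
     tend to 0. *)
  + near=> x; rewrite /= expR_ge0/= ler_peMl ?expR_ge0//.
    have x1 : 1 <= x by near: x; apply: nbhs_pinfty_ge; rewrite num_real.
    by rewrite -(powRr0 x) ler_powR// ltW.
  + exact: cvg_cst.
  + exact: powR_expR_powR_cvgy.
- move=> x x0; rewrite -power_lindley_gt0//; exact: power_lindley_ge0.
Unshelve. all: by end_near. Qed.

Let powRDp x r s : 0 < x -> x `^ (r + s) = x `^ r * x `^ s.
Proof. by move=> x0; rewrite powRD// (gt_eqF x0) implybT. Qed.

(** The factor [1 + x ^ alpha] splits the integrand into two stretched exponentials with
    [p = k + alpha] and [p = k + 2 * alpha], both positive even for [k = 0]. *)
Lemma finite_moments_power_lindley : finite_moments f.
Proof.
move=> k.
apply: (@integrable_line _ _ (fun x =>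
  C * (x `^ (k%:R + alpha - 1) * expR (- (beta * x `^ alpha)) +
       x `^ (k%:R + alpha + alpha - 1) * expR (- (beta * x `^ alpha))))).
- by move=> x x0; rewrite power_lindley_le0// mulr0.
- move=> x x0; rewrite power_lindley_gt0//.
  have -> : k%:R + alpha + alpha - 1 = k%:R + (alpha + (alpha - 1)) by ring.
  by rewrite -[k%:R + alpha - 1]addrA !powRDp// powR_mulrn ?ltW//; ring.
- have ka : 0 < k%:R + alpha by rewrite ltr_wpDl.
  have := integrableZl _ C (integrableD _
     (integrable_powR_expR_powR _ _ _ ka alpha0 beta0)
     (integrable_powR_expR_powR _ _ _ (addr_gt0 ka alpha0) alpha0 beta0)).
  by apply; exact: measurable_itv.
Qed.

Lemma is_pdf_power_lindley : is_pdf f.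
Proof.
split; [exact: measurable_power_lindley|exact: power_lindley_ge0|].
exact: integral_power_lindley.
Qed.

Let integralK (K : R) (g h : R -> R) :
  mu.-integrable `]0%R, +oo[ (fun x => (g x)%:E) /\
    (\int[mu]_(x in `]0%R, +oo[) (g x)%:E = 0)%E ->
  (forall x, x <= 0 -> h x = 0) -> (forall x, 0 < x -> h x = K * g x) ->
  (\int[mu]_x (h x)%:E = 0)%E.
Proof.
move=> [ig g0] hN hP; rewrite (integral_line _ _ hN hP).
under eq_integral do rewrite EFinM.
by rewrite (@integralZl _ _ _ mu _ _ _ ig) ?g0 ?mule0//; exact: measurable_itv.
Qed.

Let nullD (g h : R -> R) :
  mu.-integrable `]0%R, +oo[ (fun x => (g x)%:E) /\
    (\int[mu]_(x in `]0%R, +oo[) (g x)%:E = 0)%E ->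
  mu.-integrable `]0%R, +oo[ (fun x => (h x)%:E) /\
    (\int[mu]_(x in `]0%R, +oo[) (h x)%:E = 0)%E ->
  mu.-integrable `]0%R, +oo[ (fun x => (g x + h x)%:E) /\
    (\int[mu]_(x in `]0%R, +oo[) (g x + h x)%:E = 0)%E.
Proof.
move=> [ig g0] [ih h0]; split.
  by apply: (integrableD _ ig ih); exact: measurable_itv.
under eq_integral do rewrite EFinD.
by rewrite (integralD _ ig ih) ?g0 ?h0 ?adde0//; exact: measurable_itv.
Qed.

(** The exponentials of [f] and [H1] multiply to one of rate [2 * beta], which is the coefficient in
    the sine of [H1]; hence [c = 2 * beta]. *)
Lemma moment_H1 (M : R) (k : nat) : alpha < 1 / 2 ->
  (\int[mu]_x (x ^+ k * H1 alpha beta M x * f x)%:E = 0)%E.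
Proof.
move=> a2.
have p0 : 0 < k.+1%:R :> R by [].
have a02 : 0 < alpha < 1 / 2 by rewrite alpha0.
have b2 : 0 < 2 * beta by rewrite mulr_gt0.
(* The sign undoes the shift by [(k + 1) * pi] inside the sine. *)
apply: (integralK (M * C * (-1) ^+ k.+1) _ _ (integral_sin_tan0 _ _ _ p0 a02 b2)).
  by move=> x x0; rewrite power_lindley_le0// mulr0.
move=> x x0; rewrite power_lindley_gt0// /H1 ltW// sin_natpi.
have D0 : 1 + x `^ alpha != 0 by rewrite gt_eqF// ltr_pwDl ?powR_ge0.
have -> : x `^ (1 - alpha) = (x `^ (alpha - 1))^-1.
  by rewrite -powRN opprB.
have -> : x `^ (k.+1%:R - 1) = x ^+ k by rewrite -natr1 addrK powR_mulrn ?ltW.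
have -> : expR (- (2 * beta * x `^ alpha)) = expR (- (beta * x `^ alpha)) ^+ 2.
  by rewrite -expRM_natl; congr expR; ring.
have s2 : (-1) ^+ k.+1 * (-1) ^+ k.+1 = 1 :> R by rewrite -expr2 sqrr_sign.
transitivity (M * C * x ^+ k * expR (- (beta * x `^ alpha)) ^+ 2 * ((-1) ^+ k.+1 * (-1) ^+ k.+1) *
   sin (2 * beta * x `^ alpha * tan (pi * alpha))); last by ring.
rewrite s2; field.
by rewrite D0 !gt_eqF ?powR_gt0 ?addr_gt0.
Qed.

(** The growing exponential of [H2] cancels the one in [f], which leaves [a = gamma] and [c = b]. *)
Lemma moment_H2 (b gamma M : R) (k : nat) : 0 < b -> alpha < gamma < 1 / 2 ->
  (\int[mu]_x (x ^+ k * H2 alpha beta b gamma M x * f x)%:E = 0)%E.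
Proof.
move=> b0 /andP[ag g2].
have p0 : 0 < k.+1%:R :> R by [].
have a02 : 0 < gamma < 1 / 2 by rewrite (lt_trans alpha0 ag).
apply: (integralK (M * C * (-1) ^+ k.+1) _ _ (integral_sin_tan0 _ _ _ p0 a02 b0)).
  by move=> x x0; rewrite power_lindley_le0// mulr0.
move=> x x0; rewrite power_lindley_gt0// /H2 ltW// sin_natpi.
have D0 : 1 + x `^ alpha != 0 by rewrite gt_eqF// ltr_pwDl ?powR_ge0.
have -> : x `^ (1 - alpha) = (x `^ (alpha - 1))^-1.
  by rewrite -powRN opprB.
have -> : x `^ (k.+1%:R - 1) = x ^+ k by rewrite -natr1 addrK powR_mulrn ?ltW.
have -> : expR (- (beta * x `^ alpha)) = (expR (beta * x `^ alpha))^-1 by rewrite expRN.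
rewrite expRD.
have s2 : (-1) ^+ k.+1 * (-1) ^+ k.+1 = 1 :> R by rewrite -expr2 sqrr_sign.
transitivity (M * C * x ^+ k * expR (- (b * x `^ gamma)) * ((-1) ^+ k.+1 * (-1) ^+ k.+1) *
   sin (b * x `^ gamma * tan (pi * gamma))); last by ring.
rewrite s2; field.
by rewrite D0 !gt_eqF ?powR_gt0 ?expR_gt0 ?addr_gt0.
Qed.

(** The denominator of [H3] cancels against [f]. The phases [(k + alpha) * pi] and
    [(k + 2 * alpha) * pi] exceed the two angles subtracted in [H3] by the same [k * pi], so one
    sign serves both terms. *)
Lemma moment_H3 (M : R) (k : nat) : alpha < 1 / 2 ->
  (\int[mu]_x (x ^+ k * H3 alpha beta M x * f x)%:E = 0)%E.
Proof.
move=> a2.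
have a02 : 0 < alpha < 1 / 2 by rewrite alpha0.
have p1 : 0 < k%:R + alpha by rewrite ltr_wpDl.
have p2 : 0 < k%:R + 2 * alpha by rewrite ltr_wpDl// mulr_gt0.
apply: (integralK (M * C * (-1) ^+ k) _ _ (nullD _ _
  (integral_sin_tan0 _ _ _ p1 a02 beta0) (integral_sin_tan0 _ _ _ p2 a02 beta0))).
  by move=> x x0; rewrite power_lindley_le0// mulr0.
move=> x x0; rewrite power_lindley_gt0// /H3 ltW//=.
have D0 : 1 + x `^ alpha != 0 by rewrite gt_eqF// ltr_pwDl ?powR_ge0.
set y := beta * _ * tan _.
have -> : y - (k%:R + alpha) * pi = y - pi * alpha - k%:R * pi by ring.
have -> : y - (k%:R + 2 * alpha) * pi = y - 2 * pi * alpha - k%:R * pi by ring.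
rewrite !sin_natpi.
have -> : k%:R + 2 * alpha - 1 = k%:R + (alpha + (alpha - 1)) by ring.
rewrite -[k%:R + alpha - 1]addrA !powRDp// powR_mulrn ?ltW//.
have s2 : (-1) ^+ k * (-1) ^+ k = 1 :> R by rewrite -expr2 sqrr_sign.
set s := sin (y - _); set t := sin (y - _).
transitivity (M * C * ((-1) ^+ k * (-1) ^+ k) * x ^+ k * (x `^ alpha * x `^ (- 1)) * expR (- (beta * x `^ alpha)) * (s + x `^ alpha * t)); last by ring.
rewrite s2; field.
by rewrite D0 /= gt_eqF// addr_gt0.
Qed.

End power_lindley.

(** * Integrability and measurability of the perturbations *)

Section perturbations.
Context {R : realType}.
Variables alpha beta : R.
Hypotheses (alpha0 : 0 < alpha) (alpha1 : alpha < 1 / 2) (beta0 : 0 < beta).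
Local Notation mu := (@lebesgue_measure R).
Implicit Types x M : R.

Let D_gt0 x : 0 < 1 + x `^ alpha.
Proof. by rewrite ltr_pwDl ?powR_ge0. Qed.

(** Since [powR] gives 0 to the power 0 the value 1, this is what makes [H1] and [H2] vanish at the
    origin. *)
Let alpha_neq1 : 1 - alpha != 0.
Proof. by rewrite gt_eqF ?subr_gt0 ?(lt_trans alpha1)//; lra. Qed.

(** [E] stands for the exponential factor, [E'] for its majorant and [S] for the sine, so that [H1]
    and [H2] are handled alike. *)
Let norm_le M (S E E' : R) x : 0 <= E -> E <= E' -> `|S| <= 1 ->
  `|M * (x `^ (1 - alpha) / (1 + x `^ alpha)) * E * S| <=
  `|M| * (x `^ (1 - alpha) * E').
Proof.
move=> E0 EE' S1.
rewrite !normrM -!mulrA ler_wpM2l// ger0_norm ?powR_ge0// ler_wpM2l ?powR_ge0//.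
rewrite (ger0_norm E0) normfV (gtr0_norm (D_gt0 x)).
rewrite -[leRHS]mul1r ler_pM ?invr_ge0 ?mulr_ge0 ?(ltW (D_gt0 x))//.
  by rewrite invf_le1// lerDl powR_ge0.
by rewrite -[leRHS]mulr1 ler_pM.
Qed.

Lemma integrable_H1 M : mu.-integrable setT (EFin \o H1 alpha beta M).
Proof.
apply: (integrable_line (H1 alpha beta M) (fun x =>
    M * (x `^ (1 - alpha) / (1 + x `^ alpha)) * expR (- (beta * x `^ alpha))
      * sin (2 * beta * x `^ alpha * tan (pi * alpha)))).
- move=> x; rewrite /H1 le_eqVlt => /predU1P[->|x0]; last by rewrite leNgt x0.
  by rewrite lexx powR0// !(mul0r, mulr0).
- by move=> x x0; rewrite /H1 ltW.
(* The exponent [1 - alpha] is written as [p - 1] with [p = 2 - alpha > 0]. *)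
apply: (@le_integrable_pos _ _ (fun x =>
    `|M| * (x `^ (2 - alpha - 1) * expR (- (beta * x `^ alpha))))).
- by move=> x x0; derivable_pointwise => //; rewrite gt_eqF.
- move=> x x0.
  have -> : 2 - alpha - 1 = 1 - alpha by ring.
  by apply: norm_le; rewrite ?expR_ge0 ?sin_max.
- have p0 : 0 < 2 - alpha by move: alpha1; lra.
  apply: (@integrableZl _ _ _ mu _ _ `|M| _ (integrable_powR_expR_powR _ _ _ p0 alpha0 beta0)).
  exact: measurable_itv.
Qed.

Variables b gamma : R.
Hypotheses (b0 : 0 < b) (ag : alpha < gamma).

(* If [x ^ (gamma - alpha) >= 2 beta / b], the exponent is nonpositive;
   otherwise [x ^ alpha] is bounded. *)
Let expR_split_le x : 0 < x ->
  expR (beta * x `^ alpha - b * x `^ gamma) <=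
  expR (beta * (2 * beta / b) `^ (alpha / (gamma - alpha)))
    * expR (- (b / 2 * x `^ gamma)).
Proof.
move=> x0; rewrite -expRD ler_expR.
have y0 : 0 < x `^ alpha by exact: powR_gt0.
have K0 := powR_ge0 (2 * beta / b) (alpha / (gamma - alpha)).
have z0 : 0 < x `^ (gamma - alpha) by exact: powR_gt0.
have -> : x `^ gamma = x `^ alpha * x `^ (gamma - alpha).
  by rewrite -powRD ?subrKC// (gt_eqF x0) implybT.
suff : beta * x `^ alpha <= beta * (2 * beta / b) `^ (alpha / (gamma - alpha))
    + b / 2 * (x `^ alpha * x `^ (gamma - alpha)) by lra.
have [h|h] := leP (2 * beta / b) (x `^ (gamma - alpha)).
  rewrite ler_wpDl// ?mulr_ge0 ?(ltW beta0)//.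
  rewrite mulrCA mulrC ler_wpM2l ?(ltW y0)//.
  by move: h; rewrite ler_pdivrMr//; lra.
rewrite ler_wpDr//; first by rewrite !mulr_ge0 ?(ltW y0) ?(ltW z0) ?divr_ge0 ?(ltW b0).
rewrite ler_wpM2l ?(ltW beta0)//.
have ga0 : gamma - alpha != 0 by rewrite subr_eq0 gt_eqF.
have -> : x `^ alpha = (x `^ (gamma - alpha)) `^ (alpha / (gamma - alpha)).
  by rewrite -powRrM mulrC divfK.
apply: ge0_ler_powR; rewrite ?nnegrE ?(ltW z0) ?(ltW h)//.
  by rewrite divr_ge0 ?subr_ge0 ?ltW.
by rewrite (le_trans _ (ltW h))// ltW.
Qed.

Lemma integrable_H2 M : mu.-integrable setT (EFin \o H2 alpha beta b gamma M).
Proof.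
apply: (integrable_line (H2 alpha beta b gamma M) (fun x =>
    M * (x `^ (1 - alpha) / (1 + x `^ alpha))
      * expR (beta * x `^ alpha - b * x `^ gamma)
      * sin (b * x `^ gamma * tan (pi * gamma)))).
- move=> x; rewrite /H2 le_eqVlt => /predU1P[->|x0]; last by rewrite leNgt x0.
  by rewrite lexx powR0// !(mul0r, mulr0).
- by move=> x x0; rewrite /H2 ltW.
pose K := expR (beta * (2 * beta / b) `^ (alpha / (gamma - alpha))).
apply: (@le_integrable_pos _ _ (fun x =>
    `|M| * K * (x `^ (2 - alpha - 1) * expR (- (b / 2 * x `^ gamma))))).
- by move=> x x0; derivable_pointwise => //; rewrite gt_eqF.
- move=> x x0.
  have -> : 2 - alpha - 1 = 1 - alpha by ring.
  rewrite -[leRHS]mulrA [X in _ <= _ * X]mulrCA.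
  by apply: norm_le; rewrite ?expR_ge0 ?sin_max ?expR_split_le.
- have p0 : 0 < 2 - alpha by move: alpha1; lra.
  have b20 : 0 < b / 2 by rewrite divr_gt0.
  apply: (@integrableZl _ _ _ mu _ _ (`|M| * K) _
    (integrable_powR_expR_powR _ _ _ p0 (lt_trans alpha0 ag) b20)).
  exact: measurable_itv.
Qed.

Lemma measurable_H3 M : measurable_fun setT (H3 alpha beta M).
Proof.
apply: (measurable_fun_line _ (fun x =>
    M * ((sin (beta * x `^ alpha * tan (pi * alpha) - pi * alpha)
          + x `^ alpha
            * sin (beta * x `^ alpha * tan (pi * alpha) - 2 * pi * alpha))
         / (1 + x `^ alpha)))).
- by move=> x x0; rewrite /H3 leNgt x0.
- by move=> x x0; rewrite /H3 ltW.
- by move=> x x0; derivable_pointwise => //; rewrite gt_eqF.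
Qed.

End perturbations.

(* The last two conjuncts say that, for [H1] and [H2], integrability holds in
   the absolute sense over the whole line, not only locally. *)
Theorem corollary2p6 (R : realType) (alpha beta b gamma M1 M2 M3 : R)
  (f : R -> R) (hf : f = power_lindley_pdf alpha beta)
  (halpha : 0 < alpha < 1 / 2) (hbeta : 0 < beta)
  (hb : 0 < b) (hgamma : alpha < gamma < 1 / 2)
  (hM1 : sup_norm (H1 alpha beta M1) = 1%:E)
  (hM2 : sup_norm (H2 alpha beta b gamma M2) = 1%:E)
  (hM3 : sup_norm (H3 alpha beta M3) = 1%:E) :
  [/\ is_stieltjes_class f (H1 alpha beta M1)
        [set g | exists2 eps : R, -1 <= eps <= 1 &
           g = (fun x => f x * (1 + eps * H1 alpha beta M1 x))],
      is_stieltjes_class f (H2 alpha beta b gamma M2)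
        [set g | exists2 eps : R, -1 <= eps <= 1 &
           g = (fun x => f x * (1 + eps * H2 alpha beta b gamma M2 x))],
      is_stieltjes_class f (H3 alpha beta M3)
        [set g | exists2 eps : R, -1 <= eps <= 1 &
           g = (fun x => f x * (1 + eps * H3 alpha beta M3 x))],
      lebesgue_measure.-integrable setT (EFin \o H1 alpha beta M1) &
      lebesgue_measure.-integrable setT (EFin \o H2 alpha beta b gamma M2)].
Proof.
case/andP: halpha => alpha0 alpha1; case/andP: (hgamma) => ag _.
have fpdf := is_pdf_power_lindley _ _ alpha0 hbeta.
have fmom := finite_moments_power_lindley _ _ alpha0 hbeta.
have iH1 := integrable_H1 _ _ alpha0 alpha1 hbeta M1.
have iH2 := integrable_H2 _ _ alpha0 alpha1 hbeta _ _ hb ag M2.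
rewrite hf; split => //; split => //; split => //.
- exact: open_integrable_locally openT iH1.
- by move=> k; exact: moment_H1.
- exact: open_integrable_locally openT iH2.
- by move=> k; exact: moment_H2.
(* For [H3] the normalization [hM3] itself supplies the pointwise bound by 1. *)
- apply: locally_integrable_le1 => [|x]; first exact: measurable_H3.
  exact: sup_norm_le1 hM3.
- by move=> k; exact: moment_H3.
Qed.
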